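(* Let $R$ be any associative ring with $1$, let $n\ge 3$, and let $A,B$ be two-sided ideals of $R$. Then the mixed commutator subgroup $[E(n,R,A),E(n,R,B)]$ is generated as a group by the elements of the following two forms: (1) $z_{ij}(ab,c)$ and $z_{ij}(ba,c)$, (2) $[t_{ij}(a),t_{ji}(b)]$, where $1\le i\neq j\le n$, $a\in A$, $b\in B$, $c\in R$. Moreover, for the second type of generators it suffices to fix one pair of indices: for any fixed pair $(k,l)$ with $1\le k\ne l\le n$, the group $[E(n,R,A),E(n,R,B)]$ is generated by all elements $z_{ij}(ab,c)$ and $z_{ij}(ba,c)$ with $1\le i\neq j\le n$, $a\in A$, $b\in B$, $c\in R$, together with all elements $[t_{kl}(a),t_{lk}(b)]$ with $a\in A$, $b\in B$.
   Context: For an associative ring $R$ with $1$, $\operatorname{GL}(n,R)$ is the general linear group of degree $n$; $e$ is the identity matrix and $e_{ij}$ the standard matrix units. For $c\in R$ and $1\le i\ne j\le n$, $t_{ij}(c)=e+ce_{ij}$ is the elementary transvection. $E(n,R)$ is the subgroup of $\operatorname{GL}(n,R)$ generated by all $t_{ij}(c)$, $c\in R$, $1\le i\neq j\le n$. For a two-sided ideal $A$ of $R$, $E(n,A)=\langle t_{ij}(a) : a\in A,\ 1\le i\ne j\le n\rangle$, and the relative elementary subgroup $E(n,R,A)$ is the normal closure of $E(n,A)$ in $E(n,R)$. For $a,c\in R$ and $i\neq j$, $z_{ij}(a,c)=t_{ji}(c)t_{ij}(a)t_{ji}(-c)$. Commutators are $[x,y]=xyx^{-1}y^{-1}$; for subgroups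 $H,K$ of a group, $[H,K]$ is the subgroup generated by all $[h,k]$, $h\in H$, $k\in K$. *)

(* Defs.v *)
From HB Require Import structures.
From mathcomp Require Import all_boot all_algebra.
From mathcomp Require Import classical_sets.

Set Implicit Arguments.
Unset Strict Implicit.
Unset Printing Implicit Defensive.

Import GRing.Theory.

Local Open Scope classical_set_scope.
Local Open Scope group_scope.

Section Subgroups.
Variable G : groupType.
Implicit Types (x y : G) (H K X : set G).

Definition is_subgroup H : Prop :=
  [/\ H 1, forall x y, H x -> H y -> H (x * y) & forall x, H x -> H x^-1].

Definition is_normal_subgroup K H : Prop :=
  [/\ is_subgroup H, H `<=` K & forall x y, K x -> H y -> H (x * y * x^-1)].

Definition gen X : set G := smallest is_subgroup X.

Definition normal_closure K X : set G := smallest (is_normal_subgroup K) X.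

(* This is not the commutator [~ x, y] = x^-1 * y^-1 * x * y of MathComp. *)
Definition comm x y : G := x * y * x^-1 * y^-1.

Definition comm_subgroup H K : set G :=
  gen [set g | exists x y, [/\ H x, K y & g = comm x y]].

End Subgroups.

(* The ideals of ring_quotient are proper, decidable and one-sided, hence not
   usable here. *)
Definition is_ideal (R : pzRingType) (A : set R) : Prop :=
  [/\ A 0%R,
      forall x y, A x -> A y -> A (x - y)%R,
      forall r x, A x -> A (r * x)%R
    & forall r x, A x -> A (x * r)%R].

Section GeneralLinear.
Variables (R : pzRingType) (n : nat).

Definition mutual_inverse (p : 'M[R]_n * 'M[R]_n) : bool :=
  (p.1 *m p.2 == 1%:M)%R && (p.2 *m p.1 == 1%:M)%R.

(* MathComp's unit matrices require a commutative base ring. Over an arbitrary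
   R, an element of GL(n, R) is represented as a matrix packed with its
   two-sided inverse; the inverse being unique, gl_mx is injective
   (gl_mx_inj). *)
Record gl := GL { gl_pair : 'M[R]_n * 'M[R]_n; _ : mutual_inverse gl_pair }.

HB.instance Definition _ := [isSub for gl_pair].
HB.instance Definition _ := [Choice of gl by <:].

Definition gl_mx (g : gl) : 'M[R]_n := (gl_pair g).1.

Lemma gl_mulmxV (g : gl) : (gl_mx g *m (gl_pair g).2)%R = 1%:M%R.
Proof. by case: g => p gp; case/andP: (gp) => /eqP. Qed.

Lemma gl_mulVmx (g : gl) : ((gl_pair g).2 *m gl_mx g)%R = 1%:M%R.
Proof. by case: g => p gp; case/andP: (gp) => _ /eqP. Qed.

Lemma gl_mx_inj : injective gl_mx.
Proof.
move=> g h eq_gh; apply/val_inj; rewrite /= [LHS]surjective_pairing.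
rewrite [RHS]surjective_pairing -/(gl_mx g) -/(gl_mx h) eq_gh; congr (_, _).
rewrite -[LHS]mulmx1 -(gl_mulmxV h) -eq_gh mulmxA gl_mulVmx.
by rewrite mul1mx.
Qed.

Lemma gl_one_proof : mutual_inverse (1%:M, 1%:M)%R.
Proof. by rewrite /mutual_inverse /= mulmx1 eqxx. Qed.

Lemma gl_mul_proof (g h : gl) :
  mutual_inverse (gl_mx g *m gl_mx h, (gl_pair h).2 *m (gl_pair g).2)%R.
Proof.
rewrite /mutual_inverse /= -mulmxA (mulmxA (gl_mx h)) gl_mulmxV mul1mx.
rewrite gl_mulmxV eqxx -mulmxA (mulmxA _ (gl_mx g)) gl_mulVmx mul1mx.
by rewrite gl_mulVmx eqxx.
Qed.

Lemma gl_inv_proof (g : gl) : mutual_inverse ((gl_pair g).2, gl_mx g).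
Proof. by rewrite /mutual_inverse /= gl_mulVmx gl_mulmxV !eqxx. Qed.

Definition gl_one : gl := GL gl_one_proof.
Definition gl_mul (g h : gl) : gl := GL (gl_mul_proof g h).
Definition gl_inv (g : gl) : gl := GL (gl_inv_proof g).

Lemma gl_mulA : associative gl_mul.
Proof. by move=> g h k; apply: gl_mx_inj; rewrite /gl_mx /= mulmxA. Qed.

Lemma gl_mul1 : left_id gl_one gl_mul.
Proof. by move=> g; apply: gl_mx_inj; rewrite /gl_mx /= mul1mx. Qed.

Lemma gl_mulr1 : right_id gl_one gl_mul.
Proof. by move=> g; apply: gl_mx_inj; rewrite /gl_mx /= mulmx1. Qed.

Lemma gl_mulV : left_inverse gl_one gl_inv gl_mul.
Proof. by move=> g; apply: gl_mx_inj; exact: gl_mulVmx. Qed.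

Lemma gl_mulrV : right_inverse gl_one gl_inv gl_mul.
Proof. by move=> g; apply: gl_mx_inj; exact: gl_mulmxV. Qed.

HB.instance Definition _ :=
  isGroup.Build gl gl_mulA gl_mul1 gl_mulr1 gl_mulV gl_mulrV.

Lemma gl_mx1 : gl_mx 1 = 1%:M%R. Proof. by []. Qed.

Lemma gl_mxM (g h : gl) : gl_mx (g * h) = (gl_mx g *m gl_mx h)%R.
Proof. by []. Qed.

Implicit Types (i j : 'I_n) (a b c : R) (A B : set R).

Definition tmx i j c : 'M[R]_n := (1%:M + c *: delta_mx i j)%R.

(* The value is the identity in the irrelevant case i = j where tmx i j c need
   not be invertible. *)
Definition t i j c : gl :=
  if i != j then insubd (1 : gl) (tmx i j c, tmx i j (- c)%R) else 1.

Lemma tmxD i j c d : i != j -> (tmx i j c *m tmx i j d = tmx i j (c + d))%R.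
Proof.
move=> neq_ij; rewrite /tmx mulmxDl mul1mx mulmxDr mulmx1.
suff -> : ((c *: delta_mx i j) *m (d *: delta_mx i j) = 0 :> 'M[R]_n)%R.
  by rewrite addr0 scalerDl addrAC addrA.
apply/matrixP=> x y; rewrite !mxE big1 // => k _; rewrite !mxE.
case: (eqVneq k j) => [->|_]; last by rewrite andbF mulr0 mul0r.
by rewrite (eq_sym j) (negPf neq_ij) !mulr0.
Qed.

Lemma gl_mx_t i j c : i != j -> gl_mx (t i j c) = tmx i j c.
Proof.
move=> neq_ij; rewrite /t neq_ij /gl_mx -[gl_pair _]/(val _) val_insubd.
rewrite /mutual_inverse /= !tmxD // addrN addNr.
by rewrite /tmx scale0r addr0 eqxx.
Qed.

Definition z i j a c : gl := t j i c * t i j a * t j i (- c)%R.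

Definition elem_gp A : set gl :=
  gen [set g | exists i j a, [/\ i != j, A a & g = t i j a]].

(* elem_gp setT is E(n, R). *)
Definition rel_elem_gp A : set gl := normal_closure (elem_gp setT) (elem_gp A).

Definition z_gens A B : set gl :=
  [set g | exists i j a b c, [/\ i != j, A a, B b
     & g = z i j (a * b)%R c \/ g = z i j (b * a)%R c]].

Definition comm_gens_at i j A B : set gl :=
  [set g | exists a b, [/\ A a, B b & g = comm (t i j a) (t j i b)]].

Definition comm_gens A B : set gl :=
  [set g | exists i j, i != j /\ comm_gens_at i j A B g].

End GeneralLinear.

Arguments elem_gp {R} n A.
Arguments rel_elem_gp {R} n A.
Arguments z_gens {R} n A B.
Arguments comm_gens {R} n A B.

(* Main.v *)
(* Let N be generated by the z_ij(s,c) with s in AB + BA; following Vaserstein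
   and Suslin, N is normal in E(n,R), since n >= 3 allows t_ij(s) to be written
   as [t_ih(s),t_hj(1)]. Modulo N, the commutators y_ij(a,b) = [t_ij(a),t_ji(b)]
   are central in E(n,R), and conjugating t_ij(a) = [t_ih(a),t_hj(1)] by t_ji(b)
   shows that y_ij(a,b) is congruent to y_ih(a,-b)^-1. Hence the subgroup H
   generated by N and the y_kl(a,b) for one pair (k,l) is normal in E(n,R) and
   contains all y_ij(a,b), so that E(n,A) and E(n,B) commute modulo H. The same
   decomposition of t_ij(a) shows that t_ij(a) also commutes modulo H with
   z_ij(b,d). These generate E(n,R,B), and the normality of E(n,R,B) then allows
   E(n,A) to be replaced by its normal closure E(n,R,A). *)
Require Import Defs.
From mathcomp Require Import all_boot all_algebra.
From mathcomp Require Import classical_sets.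

Set Implicit Arguments.
Unset Strict Implicit.
Unset Printing Implicit Defensive.

Import GRing.Theory.

Local Open Scope classical_set_scope.
Local Open Scope group_scope.

(** * Generated subgroups and their behaviour under conjugation *)

Section Generation.
Variable G : groupType.
Implicit Types (x y g : G) (H K X Y : set G).

Lemma comm_inv x y : (comm x y)^-1 = comm y x.
Proof. by rewrite /comm !gnorm. Qed.

Lemma gen_subgroup X : is_subgroup (gen X).
Proof.
split=> [H [[]]//|x y Xx Xy H HX|x Xx H HX]; case: (HX) => -[_ HM HV] _.
  by apply: HM; [apply: Xx | apply: Xy].
by apply: HV; apply: Xx.
Qed.

Lemma gen_sub X : X `<=` gen X.
Proof. exact: sub_gen_smallest. Qed.

Lemma gen_min H X : is_subgroup H -> X `<=` H -> gen X `<=` H.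
Proof. exact: smallest_sub. Qed.

Lemma gen_conj H X g : is_subgroup H ->
  (forall x, X x -> H (x ^ g)) -> forall x, gen X x -> H (x ^ g).
Proof.
move=> [H1 HM HV] HX; apply: (@gen_min [set x | H (x ^ g)]) => //; split=> /=.
- by rewrite conj1g.
- by move=> x y Hx Hy; rewrite conjMg; apply: HM.
- by move=> x Hx; rewrite conjVg; apply: HV.
Qed.

Lemma gen_norm H Y : (forall y, Y y -> Y y^-1) ->
    (forall y x, Y y -> H x -> H (x ^ y)) ->
  forall g x, gen Y g -> H x -> H (x ^ g).
Proof.
move=> YV HY g x Yg; move: x.
(* Conjugation by [g^-1] is carried along so that the set of admissible [g] is closed under
   inverses. *)
have [//] : (forall x, H x -> H (x ^ g)) /\ (forall x, H x -> H (x ^ g^-1)).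
move: g Yg; apply: (@gen_min
  [set g | (forall x, H x -> H (x ^ g)) /\ (forall x, H x -> H (x ^ g^-1))]).
  split=> /= [|g h [gH gVH] [hH hVH]|g [gH gVH]].
  - by rewrite invg1; split=> x; rewrite conjg1.
  - split=> x Hx; first by rewrite conjgM; apply/hH/gH.
    by rewrite invgM conjgM; apply/gVH/hVH.
  - by rewrite invgK.
by move=> y Yy /=; split=> x; apply: HY => //; apply: YV.
Qed.

End Generation.

(** * Commutator calculus modulo a subgroup [H] normalised by [E] *)

Section CommutatorsModulo.
Variables (G : groupType) (E H : set G).
Hypotheses (sE : is_subgroup E) (sH : is_subgroup H).
Hypothesis nH : forall g x, E g -> H x -> H (x ^ g).
Implicit Types (x y z g u v p q : G).

Let EM x y : E x -> E y -> E (x * y). Proof. by case: sE => _ + _; apply. Qed.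
Let EV x : E x -> E x^-1. Proof. by case: sE => _ _; apply. Qed.
Let HM x y : H x -> H y -> H (x * y). Proof. by case: sH => _ + _; apply. Qed.
Let HV x : H x -> H x^-1. Proof. by case: sH => _ _; apply. Qed.

Lemma mem_comm x y : E x -> E y -> E (comm x y).
Proof. by move=> Ex Ey; do !apply: EM => //; apply: EV. Qed.

Lemma comm_modC x y : H (comm x y) -> H (comm y x).
Proof. by move/HV; rewrite comm_inv. Qed.

Lemma comm_modM x y z :
  E y -> H (comm x y) -> H (comm x z) -> H (comm x (y * z)).
Proof.
move=> Ey Hxy Hxz.
have -> : comm x (y * z) = comm x y * comm x z ^ y^-1.
  by rewrite /comm /conjg !gnorm.
by apply: HM => //; apply: nH => //; apply: EV.
Qed.

Lemma comm_modV x y : E y -> H (comm x y) -> H (comm x y^-1).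
Proof.
move=> Ey /HV/(nH Ey); congr (H _).
by rewrite /comm /conjg !gnorm.
Qed.

(** Conjugating the whole commutator by [g^-1] shifts a conjugation from one entry to the other. *)
Lemma comm_modJ x y g :
  E g -> H (comm (x ^ g) y) -> H (comm x (y ^ g^-1)).
Proof.
move=> /EV Eg /(nH Eg); congr (H _).
by rewrite /comm /conjg !gnorm.
Qed.

(** This set is the centraliser of [x] modulo [H], cut down to [E] because only elements of [E] are
    known to normalise [H]. *)
Lemma comm_mod_subgroup x : is_subgroup [set y | E y /\ H (comm x y)].
Proof.
split=> /= [|y z [Ey Hy] [Ez Hz]|y [Ey Hy]].
- split; first by case: sE.
  by rewrite /comm invg1 !mulg1 mulgV; case: sH.
- by split; [apply: EM | apply: comm_modM].
- by split; [apply: EV | apply: comm_modV].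
Qed.

Lemma comm_mod_comm x y z : E y -> E z ->
  H (comm x y) -> H (comm x z) -> H (comm x (comm y z)).
Proof.
move=> Ey Ez Hxy Hxz; have [_ sM sV] := comm_mod_subgroup x.
have Cy : E y /\ H (comm x y) by [].
have Cz : E z /\ H (comm x z) by [].
by case: (sM _ _ (sM _ _ (sM _ _ Cy Cz) (sV _ Cy)) (sV _ Cz)).
Qed.

(** Conjugation by [g] turns [[u,v]] into [[u'u,v]], which differs from [[u,v]] only by [[u',[u,v]]]
    and a conjugate of [[u',v]]; both lie in [H]. *)
Lemma comm_mod_conj g u u' v : E g -> E u' -> E u -> E v ->
    u ^ g = u' * u -> v ^ g = v -> H (comm u' u) -> H (comm u' v) ->
  H (comm g (comm u v)).
Proof.
move=> Eg Eu' Eu Ev ug vg Hu Hv.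
have Hg : H (comm g^-1 (comm u v)).
  have -> : comm g^-1 (comm u v) = comm (u ^ g) (v ^ g) / comm u v.
    by rewrite /comm /conjg !gnorm.
  have -> : comm (u ^ g) (v ^ g) / comm u v =
      comm u' (comm u v) * comm u' v ^ (comm u v)^-1.
    by rewrite ug vg /comm /conjg !gnorm.
  apply: HM; first exact: comm_mod_comm.
  by apply: nH => //; apply/EV/mem_comm.
by apply: comm_modC; rewrite -[g]invgK; apply: comm_modV;
  [apply: EV | apply: comm_modC].
Qed.

(** This lets the entries of [[p,q]] vary: on the left by an element of [H], on the right by an
    element commuting modulo [H] with [p] and with [[p,q]]. *)
Lemma comm_mod_perturb h p b q : H h -> E h -> E p -> E b -> E q ->
    H (comm p b) -> H (comm b (comm p q)) ->
  H (comm (h * p) (b * q) / comm p q).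
Proof.
move=> Hh Eh Ep Eb Eq Hpb Hbc.
have -> : comm (h * p) (b * q) / comm p q =
    h * comm p b * comm b (comm p q) * (h^-1 ^ (b * q)^-1) ^ (comm p q)^-1.
  by rewrite /comm /conjg !gnorm.
have Ec := EV (mem_comm Ep Eq).
apply: HM; first by apply: HM => //; apply: HM.
have Ebq : E (b * q)^-1 by apply/EV/EM.
by apply: (nH Ec); apply: (nH Ebq); apply: HV.
Qed.

End CommutatorsModulo.

(** * Steinberg relations for transvections, and conjugation formulas *)

Section Transvections.
Variables (R : pzRingType) (n : nat).
Implicit Types (i j k l : 'I_n) (a b c r s : R).

Lemma mul_scale_delta i j k l a b :
  ((a *: delta_mx i j) *m (b *: delta_mx k l) =
    (a * b *+ (j == k)) *: delta_mx i l :> 'M[R]_n)%R.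
Proof.
apply/matrixP=> x y; rewrite !mxE (bigD1 j) //= !mxE big1 => [|m /negPf mj].
  rewrite eqxx andbT addr0; case: (x == i); last by rewrite !(mulr0, mul0r).
  case: (j == k); last by rewrite !(mulr0, mul0r).
  by case: (y == l); rewrite /= ?(mulr1, mulr0).
by rewrite !mxE mj andbF mulr0 mul0r.
Qed.

Lemma tii i c : t i i c = 1.
Proof. by rewrite /t eqxx. Qed.

Lemma tD i j a b : t i j a * t i j b = t i j (a + b)%R.
Proof.
have [->|ij] := eqVneq i j; first by rewrite !tii mulg1.
by apply: gl_mx_inj; rewrite gl_mxM !gl_mx_t // tmxD.
Qed.

Lemma t0 i j : t i j 0%R = 1 :> gl R n.
Proof. by apply: (mulgI (t i j 0%R)); rewrite tD addr0 mulg1. Qed.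

Lemma tV i j c : (t i j c)^-1 = t i j (- c)%R.
Proof. by apply: mulg1_eq; rewrite tD addrN t0. Qed.

Lemma t_commute i j k l a b : j != k -> i != l ->
  commute (t i j a) (t k l b).
Proof.
move=> jk il; rewrite /commute.
have [->|ij] := eqVneq i j; first by rewrite !tii mulg1 mul1g.
have [->|kl] := eqVneq k l; first by rewrite !tii mulg1 mul1g.
apply: gl_mx_inj; rewrite !gl_mxM !gl_mx_t // /tmx.
rewrite !(mulmxDl, mulmxDr) !(mul1mx, mulmx1) !mul_scale_delta.
rewrite (negPf jk) (eq_sym l) (negPf il) !mulr0n !scale0r !addr0.
by rewrite addrAC.
Qed.

(** This is the Steinberg relation freed of inverses, so that both sides can be compared as
    matrices. *)
Lemma t_mul i j k a b : i != j -> j != k -> i != k ->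
  t i j a * t j k b = t i k (a * b)%R * (t j k b * t i j a).
Proof.
move=> ij jk ik; apply: gl_mx_inj; rewrite !gl_mxM !gl_mx_t // /tmx.
rewrite !(mulmxDl, mulmxDr) !(mul1mx, mulmx1) !mul_scale_delta.
rewrite eqxx ![k == _]eq_sym !(negPf jk, negPf ik).
rewrite !mulr0n !mulr1n !scale0r !(addr0, mul0mx).
by rewrite addrA; congr (_ + _)%R; rewrite addrAC.
Qed.

Lemma comm_t0 i j k l a b : j != k -> i != l ->
  comm (t i j a) (t k l b) = 1.
Proof.
by move=> jk il; rewrite /comm t_commute // mulgK mulgV.
Qed.

Lemma comm_tl i j k a b : i != j -> j != k -> i != k ->
  comm (t i j a) (t j k b) = t i k (a * b)%R.
Proof. by move=> ij jk ik; rewrite /comm t_mul // mulgA !mulgK. Qed.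

Lemma comm_tr i j k a b : i != j -> i != k -> k != j ->
  comm (t i j a) (t k i b) = t k j (- (b * a))%R.
Proof.
move=> ij ik kj; rewrite -tV -(comm_tl (j := i)) 1?[k == i]eq_sym //.
by rewrite /comm !gnorm.
Qed.

Lemma conj_t0 i j k l a b : j != k -> i != l ->
  t k l b ^ t i j a = t k l b.
Proof. by move=> jk il; rewrite /conjg -t_commute // mulKg. Qed.

Lemma conj_tr i j k a b : i != j -> j != k -> i != k ->
  t j k b ^ t i j a = t i k (- (a * b))%R * t j k b.
Proof.
move=> ij jk ik; rewrite -mulNr -(comm_tl (j := j)) // -tV.
by rewrite /comm /conjg !gnorm.
Qed.

Lemma conj_tl i j k a b : i != j -> i != k -> k != j ->
  t k i b ^ t i j a = t k j (b * a)%R * t k i b.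
Proof.
move=> ij ik kj; rewrite -[(b * a)%R]opprK -mulrN -(comm_tr (i := i)) // -tV.
by rewrite /comm /conjg !gnorm.
Qed.

Lemma zE i j s c : z i j s c = t i j s ^ t j i (- c)%R.
Proof. by rewrite /z /conjg tV opprK mulgA. Qed.

Lemma zD i j s s' c : z i j s c * z i j s' c = z i j (s + s')%R c.
Proof. by rewrite !zE -conjMg tD. Qed.

Lemma zV i j s c : (z i j s c)^-1 = z i j (- s)%R c.
Proof. by rewrite !zE -conjVg tV. Qed.

Lemma z0 i j s : z i j s 0%R = t i j s.
Proof. by rewrite zE oppr0 t0 conjg1. Qed.

Lemma zJ i j s c r : z i j s c ^ t j i r = z i j s (c - r)%R.
Proof. by rewrite !zE -conjgM tD opprB addrC. Qed.

Lemma elem_subgroup (A : set R) : is_subgroup (elem_gp n A).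
Proof. exact: gen_subgroup. Qed.

Lemma elem_t (A : set R) i j a : A a -> elem_gp n A (t i j a).
Proof.
move=> Aa; have [->|ij] := eqVneq i j.
  by rewrite tii; case: (elem_subgroup A).
by apply: gen_sub; exists i, j, a.
Qed.

(** Reduces normality in E(n,R) to conjugating one generator by one transvection; the inverse of a
    transvection is again one. *)
Lemma elem_norm (X : set (gl R n)) :
    (forall i j r x, i != j -> X x -> gen X (x ^ t i j r)) ->
  forall g x, elem_gp n setT g -> gen X x -> gen X (x ^ g).
Proof.
move=> nX; apply: gen_norm => [_ [i [j [a [ij _ ->]]]]|_ x [i [j [a [ij _
  ->]]]]].
  by exists i, j, (- a)%R; rewrite tV.
by apply: gen_conj => [|y Xy]; [apply: gen_subgroup | apply: nX].
Qed.

End Transvections.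

(** * Closure properties of ideals *)

Section Ideals.
Variables (R : pzRingType) (A : set R).
Hypothesis idA : is_ideal A.

Lemma idealN x : A x -> A (- x)%R.
Proof. by move=> Ax; rewrite -sub0r; case: idA => A0 AB _ _; apply: AB. Qed.

Lemma idealMl r x : A x -> A (r * x)%R.
Proof. by case: idA => _ _ + _; apply. Qed.

Lemma idealMr r x : A x -> A (x * r)%R.
Proof. by case: idA => _ _ _; apply. Qed.

End Ideals.

(** * Normality in E(n,R) of the group generated by the [z i j s c] with [s] in an ideal *)

Section RelativeElementary.
Variables (R : pzRingType) (n : nat).
Hypothesis n_ge3 : 3 <= n.
Implicit Types (i j k l h p q : 'I_n) (a b c d r s : R).

(** Pigeonhole: otherwise the at least three indices would all occur in the list [[:: i; j]]. *)
Lemma third_index i j : exists2 h, h != i & h != j.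
Proof.
have [h /andP[]|hij] := pickP [pred h | (h != i) && (h != j)];
  first by exists h.
have : #|'I_n| <= size [:: i; j].
  apply: leq_trans (card_size _); apply: subset_leq_card;
    apply/fintype.subsetP=> k _.
  by rewrite !inE; have /= := hij k; case: eqP; case: eqP.
by rewrite card_ord => /(leq_trans n_ge3).
Qed.

(** These are the Vaserstein-Suslin generators of E(n,R,J). For [J := circ A B] this is the group N
    of the overview. *)
Definition z_gp (J : set R) : set (gl R n) :=
  gen [set g | exists i j s c, [/\ i != j, J s & g = z i j s c]].

Lemma z_gp_subgroup (J : set R) : is_subgroup (z_gp J).
Proof. exact: gen_subgroup. Qed.

Section Ideal.
Variable J : set R.
Hypothesis idJ : is_ideal J.

Let ZM x y : z_gp J x -> z_gp J y -> z_gp J (x * y).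
Proof. by case: (z_gp_subgroup J) => _ + _; apply. Qed.

Let ZV x : z_gp J x -> z_gp J x^-1.
Proof. by case: (z_gp_subgroup J) => _ _; apply. Qed.

Lemma z_gp_z i j s c : J s -> z_gp J (z i j s c).
Proof.
move=> Js; have [->|ij] := eqVneq i j; last by apply: gen_sub;
  exists i, j, s, c.
by rewrite zE tii conj1g; case: (z_gp_subgroup J).
Qed.

Lemma z_gp_t i j s : J s -> z_gp J (t i j s).
Proof. by rewrite -z0; apply: z_gp_z. Qed.

(** Conjugation turns the second factor into a [z] and the first into transvections in row [p] with
    entries in [J]. [z_gp_row] is the transposed case. *)
Lemma z_gp_column p i j s s' c : i != j -> p != i -> p != j -> J s -> J s' ->
  z_gp J ((t p j s' * t i j s) ^ t j i (- c)%R).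
Proof.
move=> ij pi pj Js Js'; rewrite conjMg -zE conj_tl 1?[j == _]eq_sym //.
apply: ZM; last exact: z_gp_z.
by apply: ZM; apply: z_gp_t => //; apply: idealMr.
Qed.

Lemma z_gp_row q i j s s' c : i != j -> q != i -> q != j -> J s -> J s' ->
  z_gp J ((t i q s' * t i j s) ^ t j i (- c)%R).
Proof.
move=> ij; rewrite ![q == _]eq_sym => iq jq Js Js'.
rewrite conjMg -zE conj_tr 1?[j == i]eq_sym //.
apply: ZM; last exact: z_gp_z.
by apply: ZM; apply: z_gp_t => //; apply: idealN => //; apply: idealMl.
Qed.

(** Conjugate both [t i j s] and the conjugating [t j i (- c)]. If [p] lies outside [{i,j}], the
    effect is at most an extra factor [t p j s'] with [s'] in [J]; if [q] does, at most an extra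
    [t i q s']. The column and row lemmas apply. *)
Lemma z_gp_conj_outer p q r i j s c : i != j -> p != q -> J s ->
    (p != i) && (p != j) || (q != i) && (q != j) ->
  z_gp J (z i j s c ^ t p q r).
Proof.
move=> ij pq Js; have ji : j != i by rewrite eq_sym.
rewrite zE conjJg => /orP[]/andP[ne_i ne_j].
  have [ip jp] : i != p /\ j != p by rewrite ![_ == p]eq_sym.
  have [qi|q_i] := eqVneq q i.
    rewrite qi conj_tr // conj_t0 //; apply: z_gp_column => //.
    by apply: idealN => //; apply: idealMl.
  have [qj|q_j] := eqVneq q j.
    rewrite qj conj_t0 // (conj_tr _ _ ne_j ji ne_i) conjgM conj_tr //.
    by apply: z_gp_column => //; apply: idealN => //; apply: idealMl.
  by rewrite conj_t0 // conj_t0 // -zE; apply: z_gp_z.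
have [iq jq] : i != q /\ j != q by rewrite ![_ == q]eq_sym.
have [p_i|p_i] := eqVneq p i.
  rewrite p_i conj_t0 // (conj_tl _ _ iq ij jq) conjgM conj_tl //.
  by apply: z_gp_row => //; apply: idealMr.
have [p_j|p_j] := eqVneq p j.
  rewrite p_j conj_tl // conj_t0 //.
  by apply: z_gp_row => //; apply: idealMr.
by rewrite conj_t0 // conj_t0 // -zE; apply: z_gp_z.
Qed.

(** The factor with transposed indices turns the given transvection into a [z]; the other factor is
    then outer for it. For the second claim the two factors are first interchanged. *)
Lemma z_gp_conj_cross i j h s x y : i != j -> h != i -> h != j -> J s ->
  z_gp J (t i h s ^ (t h i x * t h j y)) /\
  z_gp J (t j h s ^ (t h i x * t h j y)).
Proof.
move=> ij hi hj Js.
have [ih jh] : i != h /\ j != h by rewrite ![_ == h]eq_sym.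
have ji : j != i by rewrite eq_sym.
split; last rewrite t_commute //; rewrite conjgM -z0 zJ sub0r.
- by apply: z_gp_conj_outer => //; rewrite ji jh orbT.
- by apply: z_gp_conj_outer => //; rewrite ij ih orbT.
Qed.

(* Write [t i j s] as the commutator of [t i h s] and [t h j 1]: after the two
   conjugations both entries still have their coefficients in column [h] and
   row [h], so that only conjugations covered by [z_gp_conj_outer] occur. *)
Lemma z_gp_conj_same i j r s c : i != j -> J s ->
  z_gp J (z i j s c ^ t i j r).
Proof.
move=> ij Js; have [h hi hj] := third_index i j.
have [ih jh] : i != h /\ j != h by rewrite ![_ == h]eq_sym.
have ji : j != i by rewrite eq_sym.
have commJ u v g : comm u v ^ g = u ^ g * (u ^ g)^-1 ^ (v ^ g)^-1 :> gl R n.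
  by rewrite /comm /conjg !gnorm.
rewrite zE -[s]mulr1 -(comm_tl s 1%R ih hj ij).
rewrite -conjgM commJ !conjgM.
rewrite (conj_tr _ _ ji ih jh) (conj_tl _ _ ji jh hi) !conjMg.
rewrite (conj_tr _ _ ij jh ih) (conj_tl _ _ ij ih hj).
rewrite !(conj_t0 _ _ ji ih) !(conj_t0 _ _ jh ij).
set u := (- (r * _))%R; set v := (- (- c * s))%R.
have Jv : J v by apply: idealN => //; apply: idealMl.
have Ju : J u by apply: idealN => //; do 2!apply: idealMl => //.
(* The conjugating element lies in row [h]; its inverse is collected into the two factors expected
   by [z_gp_conj_cross]. *)
have tt x y : (t h j x * t h i y * t h j 1%R)^-1 =
    t h i (- y)%R * t h j (- (x + 1))%R :> gl R n.
  by rewrite -mulgA (t_commute y 1%R ih hj) mulgA tD invgM !tV.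
rewrite tt.
(* The first three transvections have entries in [J]. What remains is the inverse of their product,
   conjugated by the row [h] element. *)
apply: ZM; first by do !apply: ZM; apply: z_gp_t.
rewrite conjVg !conjMg.
have cross w : J w -> _ := @z_gp_conj_cross i j h w (- (1 * - c))%R
  (- (1 * - c * r + 1))%R ij hi hj.
apply: ZV; apply: ZM; last by case: (cross s).
by apply: ZM; [case: (cross u) | case: (cross v)].
Qed.

(** Three positions of [(p,q)]: equal to [(j,i)], where only the parameter [c] shifts, equal to
    [(i,j)], or having an index outside [{i,j}]. *)
Lemma z_gp_norm g x : elem_gp n setT g -> z_gp J x -> z_gp J (x ^ g).
Proof.
apply: elem_norm => p q r _ pq [i [j [s [c [ij Js ->]]]]].
have [pj|p_j] := eqVneq p j.
  have [qi|q_i] := eqVneq q i; first by rewrite pj qi zJ; apply: z_gp_z.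
  apply: z_gp_conj_outer => //; rewrite q_i /= -pj orbC [q == p]eq_sym.
  by rewrite pq.
have [pi|p_i] := eqVneq p i; last by apply: z_gp_conj_outer; rewrite ?p_i ?p_j.
have [qj|q_j] := eqVneq q j; first by rewrite pi qj; apply: z_gp_conj_same.
apply: z_gp_conj_outer => //; rewrite q_j -pi [q == p]eq_sym.
by rewrite pq orbT.
Qed.

Lemma z_gp_sub_elem x : z_gp J x -> elem_gp n setT x.
Proof.
apply: gen_min; first exact: elem_subgroup.
move=> _ [i [j [s [c [_ _ ->]]]]]; have [_ EM _] := elem_subgroup n (@setT R).
by apply: (EM); [apply: (EM) |]; apply: elem_t.
Qed.

Lemma rel_elem_sub_z_gp : rel_elem_gp n J `<=` z_gp J.
Proof.
apply: smallest_sub.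
  split; [exact: z_gp_subgroup | exact: z_gp_sub_elem | move=> x y Ex Zy].
  have [_ _ EV] := elem_subgroup n (@setT R).
  have := z_gp_norm (EV _ Ex) Zy; congr (z_gp J _).
  by rewrite /conjg !gnorm.
apply: gen_min; first exact: z_gp_subgroup.
by move=> _ [i [j [s [_ Js ->]]]]; apply: z_gp_t.
Qed.

Lemma rel_elem_normal : is_normal_subgroup (elem_gp n setT) (rel_elem_gp n J).
Proof.
have sE := elem_subgroup n (@setT R).
split; first split=> [H [[[]]]//|x y Xx Xy H HX|x Xx H HX].
- by case: (HX) => -[[_ HM _] _ _] _; apply: HM; [apply: Xx | apply: Xy].
- by case: (HX) => -[[_ _ HV] _ _] _; apply: HV; apply: Xx.
(* An intersection of normal subgroups lies in E(n,R) once one of them is exhibited; [z_gp J] is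
   that one. *)
- by move=> x /rel_elem_sub_z_gp/z_gp_sub_elem.
- move=> x y Ex Xy H HX; case: (HX) => -[_ _ HJ] _; apply: HJ => //.
  exact: Xy.
Qed.

End Ideal.

(** * The ideal AB + BA *)

(** This is AB + BA, taken as the additive subgroup generated by the products, so that additive
    statements need checking only on [a * b] and [b * a]. *)
Definition circ (A B : set R) : set R :=
  smallest (fun X => X 0%R /\ forall x y, X x -> X y -> X (x - y)%R)
    [set s | exists a b, [/\ A a, B b & s = (a * b)%R \/ s = (b * a)%R]].

Lemma circ_min (A B X : set R) :
    X 0%R -> (forall x y, X x -> X y -> X (x - y)%R) ->
    (forall a b, A a -> B b -> X (a * b)%R /\ X (b * a)%R) ->
  circ A B `<=` X.
Proof.
move=> X0 XB XAB; apply: smallest_sub => //.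
by move=> _ [a [b [Aa Bb [->|->]]]]; case: (XAB a b Aa Bb).
Qed.

Lemma circ0 (A B : set R) : circ A B 0%R.
Proof. by move=> X [[]]. Qed.

Lemma circB (A B : set R) x y : circ A B x -> circ A B y -> circ A B (x - y)%R.
Proof.
by move=> Ix Iy X HX; case: (HX) => -[_ XB] _; apply: XB;
  [apply: Ix | apply: Iy].
Qed.

Lemma circ_mull (A B : set R) a b : A a -> B b -> circ A B (a * b)%R.
Proof. by move=> Aa Bb; apply: sub_gen_smallest; exists a, b; split=> //;
  left. Qed.

Lemma circ_mulr (A B : set R) a b : A a -> B b -> circ A B (b * a)%R.
Proof. by move=> Aa Bb; apply: sub_gen_smallest; exists a, b; split=> //;
  right. Qed.

Lemma circC (A B : set R) : circ A B = circ B A.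
Proof.
have sub (A' B' : set R) : circ A' B' `<=` circ B' A'.
  apply: circ_min; [exact: circ0 | exact: circB |] => a b Aa Bb.
  by split; [apply: circ_mulr | apply: circ_mull].
by apply/seteqP; split; apply: sub.
Qed.

Lemma circ_ideal (A B : set R) : is_ideal A -> is_ideal B -> is_ideal (circ A
  B).
Proof.
move=> idA idB; split; [exact: circ0 | exact: circB | |] => r.
- apply: (@circ_min _ _ [set s | circ A B (r * s)%R]) => /= [|x y|a b Aa Bb].
  + by rewrite mulr0; apply: circ0.
  + by rewrite mulrBr; apply: circB.
  + by rewrite !mulrA; split; [apply: circ_mull | apply: circ_mulr] => //;
    apply: idealMl.
- apply: (@circ_min _ _ [set s | circ A B (s * r)%R]) => /= [|x y|a b Aa Bb].
  + by rewrite mul0r; apply: circ0.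
  + by rewrite mulrBl; apply: circB.
  + by rewrite -!mulrA; split; [apply: circ_mull | apply: circ_mulr] => //;
    apply: idealMr.
Qed.

(** Since [z i j s c] is additive in [s], the products [a * b] and [b * a] yield every [s] in AB +
    BA. *)
Lemma z_gp_circ_sub (A B : set R) H : is_subgroup H -> z_gens n A B `<=` H ->
  z_gp (circ A B) `<=` H.
Proof.
move=> sH zH; have [H1 HM HV] := sH;
  apply: gen_min => // _ [i [j [s [c [ij Is ->]]]]].
move: s Is; apply: (@circ_min _ _ [set s | H (z i j s c)]) => /= [|x y Hx Hy|a
  b Aa Bb].
- by rewrite zE t0 conj1g.
- by rewrite -zD -zV; apply: (HM) => //; apply: HV.
- by split; apply: zH; exists i, j, a, b, c; split=> //; [left | right].
Qed.

Let E := elem_gp n (@setT R).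

Let sE : is_subgroup E. Proof. exact: elem_subgroup. Qed.

Let Et i j c : E (t i j c). Proof. exact: elem_t. Qed.

Hint Resolve Et : core.

Let EV x : E x -> E x^-1. Proof. by case: sE => _ _; apply. Qed.

(** * Centrality of the commutators [[t i j a, t j i b]] modulo N *)

Section Central.
Variables A B : set R.
Hypotheses (idA : is_ideal A) (idB : is_ideal B).

Let N := z_gp (circ A B).
Let idI := circ_ideal idA idB.
Let sN : is_subgroup N := z_gp_subgroup (circ A B).
Let nN g x (Eg : E g) (Nx : N x) : N (x ^ g) := z_gp_norm idI Eg Nx.

(** In these positions [t p q r] fixes [t j i b] and multiplies [t i j a] by a transvection that
    commutes with it and whose commutator with [t j i b] has its entry in AB + BA. *)
Lemma comm_central_outer i j p q a b r : i != j -> A a -> B b ->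
    (q == i) && (p != i) && (p != j) || (p == j) && (q != i) && (q != j) ->
  N (comm (t p q r) (comm (t i j a) (t j i b))).
Proof.
move=> ij Aa Bb; have ji : j != i by rewrite eq_sym.
have N1 : N 1 by case: sN.
case/orP=> /andP[/andP[/eqP -> ne_i] ne_j].
  apply: (comm_mod_conj sE sN nN (u' := t p j (- (r * a))%R)) => //.
  - by rewrite conj_tr.
  - by rewrite conj_t0.
  - by rewrite comm_t0.
  - rewrite comm_tl //; apply: z_gp_t => //.
    by apply: circ_mull => //; apply: idealN => //; apply: idealMl.
have [iq jq] : i != q /\ j != q by rewrite ![_ == q]eq_sym.
apply: (comm_mod_conj sE sN nN (u' := t i q (a * r)%R)) => //.
- by rewrite conj_tl.
- by rewrite conj_t0.
- by rewrite comm_t0.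
- rewrite comm_tr //; apply: z_gp_t => //; apply: (idealN idI).
  by apply: circ_mulr => //; apply: idealMr.
Qed.

End Central.

(** Outer transvections that move [t j i b] are treated by inverting the commutator and exchanging
    [A] and [B]; the other outer ones move at most [t i j a]. If [{p,q}] is [{i,j}], then [t p q r]
    is the commutator of two outer transvections through a third index. *)
Lemma comm_central (A B : set R) i j p q a b r :
    is_ideal A -> is_ideal B -> i != j -> p != q -> A a -> B b ->
  z_gp (circ A B) (comm (t p q r) (comm (t i j a) (t j i b))).
Proof.
move=> idA idB ij pq Aa Bb; have ji : j != i by rewrite eq_sym.
have idI := circ_ideal idA idB; have sN := z_gp_subgroup (circ A B).
have nN := z_gp_norm idI.
have Ey : E (comm (t i j a) (t j i b)) by apply: (mem_comm sE).
have outer k l s : k != l -> (k != i) && (k != j) || (l != i) && (l != j) ->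
    z_gp (circ A B) (comm (t k l s) (comm (t i j a) (t j i b))).
  move=> kl kl_outer.
  have [|c1] := boolP ((l == i) && (k != i) && (k != j)
                   || (k == j) && (l != i) && (l != j)).
    exact: comm_central_outer.
  have [c2|c2] := boolP ((l == j) && (k != j) && (k != i)
                   || (k == i) && (l != j) && (l != i)).
    rewrite -[comm (t i j a) _]comm_inv; apply: (comm_modV sN nN).
      exact: (mem_comm sE).
    by rewrite circC; apply: (comm_central_outer idB idA).
  have [l_i l_j k_i k_j] : [/\ l != i, l != j, k != i & k != j].
    move: kl_outer c1 c2.
    by case: (k == i); case: (k == j); case: (l == i); case: (l == j).
  apply: (comm_mod_conj sE sN nN (u' := 1)) => //; first by case: sE.
  - by rewrite mul1g conj_t0.
  - by rewrite conj_t0.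
  - by rewrite /comm !gnorm; case: sN.
  - by rewrite /comm !gnorm; case: sN.
have [|inner] := boolP ((p != i) && (p != j) || (q != i) && (q != j)).
  exact: outer.
have [h hi hj] := third_index i j.
have [ih jh] : i != h /\ j != h by rewrite ![_ == h]eq_sym.
have trans k l s : k != l -> k != h -> l != h ->
    z_gp (circ A B) (comm (t k l s) (comm (t i j a) (t j i b))).
  move=> kl kh lh; have hl : h != l by rewrite eq_sym.
  rewrite -[s]mulr1 -(comm_tl _ _ kh hl kl); apply: (comm_modC sN).
  by apply: (comm_mod_comm sE sN nN) => //; apply: (comm_modC sN);
    apply: outer; rewrite ?hi ?hj ?orbT.
move: inner; rewrite negb_or !negb_and !negbK => /andP[p_ij q_ij].
by apply: trans => //; [case/orP: p_ij | case/orP: q_ij] => /eqP ->.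
Qed.

(** * Changing the index pair of [[t i j a, t j i b]] modulo [H] *)

Section SpreadCommutators.
Variables (A B : set R) (H : set (gl R n)).
Hypotheses (idA : is_ideal A) (idB : is_ideal B).
Hypothesis sH : is_subgroup H.
Hypothesis nH : forall g x, E g -> H x -> H (x ^ g).
Hypothesis NH : z_gp (circ A B) `<=` H.

(** Write [t i j a] as [[t i h a, t h j 1]]. Conjugating by [t j i (- b)] multiplies the entries on
    the left by [t j h (b * a)], which lies in N, and by [t h i (- b)], which commutes with
    [t i h a] modulo [H] by assumption: an instance of [comm_mod_perturb]. *)
Lemma comm_move_index i j h a b : i != j -> h != i -> h != j ->
    (forall b', B b' -> H (comm (t i h a) (t h i b'))) -> A a -> B b ->
  H (comm (t i j a) (t j i b)).
Proof.
move=> ij hi hj Hih Aa Bb; have ji : j != i by rewrite eq_sym.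
have [ih jh] : i != h /\ j != h by rewrite ![_ == h]eq_sym.
have [_ _ HV] := sH; rewrite -comm_inv; apply: (HV).
have cE : t i j a = comm (t i h a) (t h j 1%R) by rewrite comm_tl // mulr1.
have -> : comm (t j i b) (t i j a) =
    comm (t i h a ^ t j i (- b)%R) (t h j 1%R ^ t j i (- b)%R) / t i j a.
  by rewrite cE -tV /comm /conjg !gnorm.
rewrite conj_tr // conj_tl // mul1r mulNr opprK [in X in _ / X]cE.
apply: (comm_mod_perturb sE sH nH) => //.
- by apply: NH; apply: z_gp_t; apply: circ_mulr.
- by apply: Hih; apply: idealN.
- rewrite -cE comm_tl //; apply: NH; apply: z_gp_t; apply: circ_mulr => //.
  exact: idealN.
Qed.

End SpreadCommutators.

(** * E(n,R,A) and E(n,R,B) commute modulo [H] *)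

Section CommuteModulo.
Variables (A B : set R) (H : set (gl R n)).
Hypotheses (idA : is_ideal A) (idB : is_ideal B).
Hypothesis sH : is_subgroup H.
Hypothesis nH : forall g x, E g -> H x -> H (x ^ g).
Hypothesis NH : z_gp (circ A B) `<=` H.

(** [comm_move_index] replaces the second index ([right]); exchanging [A] and [B] and inverting, it
    replaces the first ([left]). *)
Lemma comm_all_indices k l : k != l ->
    (forall a b, A a -> B b -> H (comm (t k l a) (t l k b))) ->
  forall i j a b, i != j -> A a -> B b -> H (comm (t i j a) (t j i b)).
Proof.
pose Y i j := forall a b, A a -> B b -> H (comm (t i j a) (t j i b)).
move=> kl; rewrite -/(Y k l) => Ykl i j a b ij Aa Bb.
suff : Y i j by apply.
have right i1 j1 h : i1 != j1 -> h != i1 -> h != j1 -> Y i1 h -> Y i1 j1.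
  move=> ij1 hi hj Yih a1 b1 Aa1 Bb1.
  by apply: (comm_move_index idB sH nH NH ij1 hi hj) => // b2; apply: Yih.
have [_ _ HV] := sH.
have NH' : z_gp (circ B A) `<=` H by rewrite circC.
have left i1 j1 h : i1 != j1 -> h != i1 -> h != j1 -> Y h j1 -> Y i1 j1.
  rewrite eq_sym => ji1 hi hj Yhj a1 b1 Aa1 Bb1; rewrite -comm_inv; apply: (HV).
  apply: (comm_move_index idA sH nH NH' ji1 hj hi) => // a2 Aa2.
  by rewrite -comm_inv; apply: (HV); apply: Yhj.
have ji : j != i by rewrite eq_sym.
have lk : l != k by rewrite eq_sym.
have [ki|k_i] := eqVneq k i.
  have [lj|l_j] := eqVneq l j; first by rewrite -ki -lj.
  by apply: (right _ _ l); rewrite // -ki.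
have [lj|l_j] := eqVneq l j; first by apply: (left _ _ k); rewrite // -lj.
have [li|l_i] := eqVneq l i; last first.
  by apply: (right _ _ l) => //; apply: (left _ _ k); rewrite // eq_sym.
have [kj|k_j] := eqVneq k j; last first.
  apply: (left _ _ k) => //; apply: (right _ _ l) => //.
(* The transposed pair needs three moves: [(j,i)] to [(j,h)] to [(i,h)] to [(i,j)]. *)
rewrite li kj in Ykl.
have [h hi hj] := third_index i j.
have [ih jh] : i != h /\ j != h by rewrite ![_ == h]eq_sym.
apply: (right _ _ h) => //; apply: (left _ _ j) => //.
by apply: (right _ _ i).
Qed.

Hypothesis Y : forall i j a b, i != j -> A a -> B b ->
  H (comm (t i j a) (t j i b)).

Let H1 : H 1. Proof. by case: sH. Qed.

Lemma comm_t_mod i j p q a b : A a -> B b -> H (comm (t i j a) (t p q b)).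
Proof.
move=> Aa Bb.
have [->|ij] := eqVneq i j; first by rewrite tii /comm !gnorm.
have [->|pq] := eqVneq p q; first by rewrite tii /comm !gnorm.
have [jp|jp] := eqVneq j p; have [iq|iq] := eqVneq i q.
- by rewrite -jp -iq; apply: Y.
- rewrite -jp comm_tl //; last by rewrite jp.
  by apply: NH; apply: z_gp_t; apply: circ_mull.
- rewrite -iq comm_tr //; try by rewrite eq_sym // iq.
  by rewrite -mulNr; apply: NH; apply: z_gp_t; apply: circ_mulr => //;
    apply: idealN.
- by rewrite comm_t0.
Qed.

Let Cmod x y : H (comm x y) -> H (comm y x). Proof. exact: comm_modC. Qed.

Lemma comm_t_mul_mod i j p q p' q' a b b' : A a -> B b -> B b' ->
  H (comm (t i j a) (t p q b * t p' q' b')).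
Proof. by move=> Aa Bb Bb'; apply: (comm_modM sE sH nH) => //;
  apply: comm_t_mod. Qed.

(** The conjugation inside [z p q b d] is shifted onto [t i j a]. As [(i,j)] is not [(p,q)], it
    creates at most one further transvection, with entry in [A]. *)
Lemma comm_tz_mod_neq i j p q a b d : (i, j) != (p, q) -> p != q ->
  A a -> B b -> H (comm (t i j a) (z p q b d)).
Proof.
have [->|ij] := eqVneq i j.
  by rewrite tii /comm !gnorm.
rewrite xpair_eqE => ij_pq pq Aa Bb; have qp : q != p by rewrite eq_sym.
have tM x y : H (comm x (t p q b)) -> H (comm y (t p q b)) ->
    E x -> H (comm (x * y) (t p q b)).
  by move=> Hx Hy Ex; apply: Cmod; apply: (comm_modM sE sH nH) => //;
    apply: Cmod.
rewrite zE -tV; apply: (comm_modJ sE nH) => //.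
have [pi|p_i] := eqVneq p i.
  have jq : j != q by move: ij_pq; rewrite pi eqxx.
  subst i; rewrite conj_tr 1?[q == j]eq_sym //.
  apply: tM => //; apply: comm_t_mod => //.
  by apply: idealN => //; apply: idealMl.
have [jq|j_q] := eqVneq j q.
  subst j; rewrite conj_tl 1?[i == p]eq_sym //; last by rewrite eq_sym.
  by apply: tM => //; apply: comm_t_mod => //; apply: idealMr.
by rewrite conj_t0 // 1?[q == j]eq_sym //; apply: comm_t_mod.
Qed.

(** For equal index pairs write [t i j a] as [[t i h a, t h j 1]]. Conjugation by [w^-1] changes the
    first entry by an element of [H], by the previous lemma, and the second by transvections with
    entries in [B]; [comm_mod_perturb] concludes. *)
Lemma comm_tz_mod i j p q a b d : p != q ->
  A a -> B b -> H (comm (t i j a) (z p q b d)).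
Proof.
have [[-> ->] {i j} ij Aa Bb|] := eqVneq (i, j) (p, q);
  last exact: comm_tz_mod_neq.
move: p q ij => i j ij; have ji : j != i by rewrite eq_sym.
have [h hi hj] := third_index i j.
have [ih jh] : i != h /\ j != h by rewrite ![_ == h]eq_sym.
set w := z i j b d; apply: Cmod.
have Ew : E w := z_gp_sub_elem (z_gp_z i j d Bb).
have cE : t i j a = comm (t i h a) (t h j 1%R) by rewrite comm_tl // mulr1.
have wq : t h j 1%R ^ w^-1 =
    t h i (d * - b * - d)%R * t h j (d * - b)%R * t h j 1%R.
  have conjJ (x y g : gl R n) : x ^ (y ^ g) = ((x ^ g^-1) ^ y) ^ g.
    by rewrite /conjg !gnorm.
  rewrite zV zE conjJ tV opprK (conj_tl _ _ ji jh hi) mul1r.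
  rewrite (conjMg (t h i d) (t h j 1%R)).
  rewrite (conj_tl _ _ ij ih hj) (conj_t0 _ _ jh ij).
  rewrite -[X in X ^ _]mulgA.
  (* Refolding this product as a conjugate lets the outer conjugation by [t j i (- d)] cancel it. *)
  have -> : t h i d * t h j 1%R = t h j 1%R ^ t j i d.
    by rewrite (conj_tl _ _ ji jh hi) mul1r.
  rewrite (conjMg (t h j _)) -(conjgM (t h j _)) tD addrN t0 conjg1.
  by rewrite (conj_tl _ _ ji jh hi).
have -> : comm w (t i j a) =
    comm (comm w (t i h a) * t i h a)
      (t h i (d * - b * - d)%R * t h j (d * - b)%R * t h j 1%R)
    / comm (t i h a) (t h j 1%R).
  have commR (x p q : gl R n) :
      comm x (comm p q) = comm (comm x p * p) (q ^ x^-1) / comm p q.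
    by rewrite /comm /conjg !gnorm.
  by rewrite -wq -commR cE.
have Bdb : B (d * - b)%R by apply: idealMl => //; apply: idealN.
have Bdbd : B (d * - b * - d)%R by apply: idealMr.
have [_ EM _] := sE.
apply: (comm_mod_perturb sE sH nH) => //.
- apply: Cmod; apply: comm_tz_mod_neq => //.
  by rewrite xpair_eqE eqxx.
- exact: (mem_comm sE).
- exact: EM.
- exact: comm_t_mul_mod.
- by rewrite -cE; apply: Cmod; apply: comm_t_mul_mod.
Qed.

(** For a transvection [x] it suffices to test the generators [z] of a group containing E(n,R,B).
    The set [K] of elements commuting modulo [H] with all of E(n,R,B) is normal in E(n,R), because
    E(n,R,B) is, so it contains the normal closure of E(n,A). *)
Lemma comm_rel_elem_mod x y :
  rel_elem_gp n A x -> rel_elem_gp n B y -> H (comm x y).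
Proof.
have [relB_group _ relB_J] := rel_elem_normal idB.
have sC v := comm_mod_subgroup sE sH nH v.
have tC i j a v : A a -> rel_elem_gp n B v -> H (comm (t i j a) v).
  move=> Aa /(rel_elem_sub_z_gp idB) Zv.
  suff [] : E v /\ H (comm (t i j a) v) by [].
  move: v Zv; apply: gen_min; first exact: sC.
  move=> _ [k [l [b [c [kl Bb ->]]]]] /=.
  by split; [apply: (z_gp_sub_elem (z_gp_z k l c Bb)) | apply: comm_tz_mod].
pose K := [set u | E u /\ forall v, rel_elem_gp n B v -> H (comm u v)].
have sK : is_subgroup K.
  split=> [|u v [Eu Hu] [Ev Hv]|u [Eu Hu]].
  - split=> [|v _]; first by case: sE.
    by rewrite /comm !gnorm.
  - split=> [|w Bw]; first by case: sE => _ + _; apply.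
    have [_ + _] := sC w => /(_ u v)[]; try by split=> //; apply/Cmod/Hu.
      by split=> //; apply/Cmod/Hv.
    by move=> _ /Cmod.
  - split=> [|w Bw]; first exact: EV.
    by apply: Cmod; apply: (comm_modV sH nH) => //; apply/Cmod/Hu.
suff sub : rel_elem_gp n A `<=` K by move=> /sub[_]; apply.
apply: smallest_sub; last first.
  apply: gen_min => // _ [i [j [a [_ Aa ->]]]].
  by split=> // v Bv; apply: tC.
split=> // [u []//|g u Eg [Eu Hu]].
have -> : g * u * g^-1 = u ^ g^-1 by rewrite /conjg !gnorm.
split=> [|v Bv].
  have [_ EM _] := sE; rewrite /conjg invgK; apply: (EM) => //.
  by apply: (EM) => //; apply: EV.
apply: Cmod; apply: (comm_modJ sE nH) => //; apply: Cmod; apply: Hu.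
have := relB_J _ _ (EV Eg) Bv; congr (rel_elem_gp _ _ _).
by rewrite /conjg !gnorm.
Qed.

End CommuteModulo.

(** * Comparison of the commutator subgroup with the generated groups *)

Lemma z_gens_sub_z_gp (A B : set R) : z_gens n A B `<=` z_gp (circ A B).
Proof.
move=> _ [i [j [a [b [c [_ Aa Bb [->|->]]]]]]]; apply: z_gp_z.
  exact: circ_mull.
exact: circ_mulr.
Qed.

Lemma comm_sub_rel_elem_comm (A B : set R) i j k l a b :
    is_ideal A -> is_ideal B -> A a -> B b ->
  comm_subgroup (rel_elem_gp n A) (rel_elem_gp n B)
    (comm (t i j a) (t k l b)).
Proof.
move=> idA idB Aa Bb; apply: gen_sub; exists (t i j a), (t k l b).
by split=> //; apply: sub_gen_smallest; apply: elem_t.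
Qed.

Lemma rel_elem_comm_conj (A B : set R) g x :
    is_ideal A -> is_ideal B -> E g ->
  comm_subgroup (rel_elem_gp n A) (rel_elem_gp n B) x ->
  comm_subgroup (rel_elem_gp n A) (rel_elem_gp n B) (x ^ g).
Proof.
move=> idA idB Eg; apply: gen_conj => [|_ [u [v [Au Bv ->]]]].
  exact: gen_subgroup.
have relJ C w : is_ideal C -> rel_elem_gp n C w -> rel_elem_gp n C (w ^ g).
  move=> idC Cw; have [_ _ CJ] := rel_elem_normal idC.
  have := CJ _ _ (EV Eg) Cw; congr (rel_elem_gp _ _ _).
  by rewrite /conjg !gnorm.
apply: gen_sub; exists (u ^ g), (v ^ g).
by split; [apply: relJ | apply: relJ | rewrite /comm /conjg !gnorm].
Qed.

(** A third index gives [t i j (a * b)] as [[t i h a, t h j b]], and dually for [b * a] after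
    inversion; conjugation then gives the [z]. *)
Lemma rel_elem_comm_z_gens (A B : set R) : is_ideal A -> is_ideal B ->
  z_gens n A B `<=` comm_subgroup (rel_elem_gp n A) (rel_elem_gp n B).
Proof.
move=> idA idB x [i [j [a [b [c [ij Aa Bb eq_x]]]]]].
have [h hi hj] := third_index i j; have ih : i != h by rewrite eq_sym.
case: eq_x => {x}->; rewrite zE; apply: rel_elem_comm_conj => //.
  by rewrite -(comm_tl a b ih hj ij); apply: comm_sub_rel_elem_comm.
have [_ _ CV] := gen_subgroup [set g | exists x y, 
  [/\ rel_elem_gp n A x, rel_elem_gp n B y & g = comm x y]].
rewrite -(comm_tl b a ih hj ij) -comm_inv; apply: (CV).
exact: comm_sub_rel_elem_comm.
Qed.

Lemma rel_elem_comm_sub_gen (A B : set R) k l :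
    is_ideal A -> is_ideal B -> k != l ->
  comm_subgroup (rel_elem_gp n A) (rel_elem_gp n B) `<=`
    gen (z_gens n A B `|` comm_gens_at k l A B).
Proof.
move=> idA idB kl; set X := z_gens n A B `|` _.
have sH : is_subgroup (gen X) by apply: gen_subgroup.
have NH : z_gp (circ A B) `<=` gen X.
  by apply: z_gp_circ_sub => // x zx; apply: gen_sub; left.
have nH g x : E g -> gen X x -> gen X (x ^ g).
  apply: elem_norm => p q r y pq [zy|[a [b [Aa Bb ->]]]].
    apply: NH; apply: (z_gp_norm (circ_ideal idA idB) (Et p q r)).
    exact: z_gens_sub_z_gp.
  (* By centrality modulo N, the conjugate differs from the generator by a factor in N. *)
  have -> : comm (t k l a) (t l k b) ^ t p q r =
      comm (t p q (- r)%R) (comm (t k l a) (t l k b))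
      * comm (t k l a) (t l k b).
    by rewrite -tV /comm /conjg !gnorm.
  have [_ HM _] := sH; apply: (HM); first by apply: NH; apply: comm_central.
  by apply: gen_sub; right; exists a, b.
apply: gen_min => // _ [x [y [Ax By ->]]].
apply: (comm_rel_elem_mod idA idB sH nH NH _ Ax By).
apply: (comm_all_indices idA idB sH nH NH kl) => a b Aa Bb.
by apply: gen_sub; right; exists a, b.
Qed.

End RelativeElementary.

Theorem theorem1 (R : pzRingType) (n : nat) (A B : set R)
    (n_ge3 : 3 <= n) (idA : is_ideal A) (idB : is_ideal B) :
  comm_subgroup (rel_elem_gp n A) (rel_elem_gp n B)
    = gen (z_gens n A B `|` comm_gens n A B)
  /\ (forall k l : 'I_n, k != l ->
        comm_subgroup (rel_elem_gp n A) (rel_elem_gp n B)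
          = gen (z_gens n A B `|` comm_gens_at k l A B)).
Proof.
set C := comm_subgroup _ _; pose X := z_gens n A B `|` comm_gens n A B.
have XC : gen X `<=` C.
  apply: gen_min => [|x [zx|[i [j [_ [a [b [Aa Bb ->]]]]]]]].
  - exact: gen_subgroup.
  - exact: rel_elem_comm_z_gens zx.
  - exact: comm_sub_rel_elem_comm.
have atX k l : k != l ->
    gen (z_gens n A B `|` comm_gens_at k l A B) `<=` gen X.
  move=> kl; apply: gen_min => [|x [zx|klx]]; first exact: gen_subgroup.
    by apply: gen_sub; left.
  by apply: gen_sub; right; exists k, l.
(* This closes the cycle of inclusions from [C] to the one-pair group, to [gen X], and back to
   [C]. *)
have Cat k l (kl : k != l) := rel_elem_comm_sub_gen n_ge3 idA idB kl.
split; last first.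
  move=> k l kl; apply/seteqP; split; first exact: Cat.
  by move=> x /(atX _ _ kl)/XC.
(* [Ordinal n_ge3] is the index 2, as [3 <= n] is [2 < n]; with [h] it forms a pair of distinct
   indices through which the cycle runs. *)
have [h _ h0] := third_index n_ge3 (Ordinal n_ge3) (Ordinal n_ge3).
by apply/seteqP; split=> // x /(Cat _ _ h0)/(atX _ _ h0).
Qed.
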